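(* Let $Q\subset\mathbb{R}^n$ be closed and convex, and consider the problem of minimizing a convex function $f$ over $x\in Q$ subject to $g(x)\leqslant 0$ with $g$ convex. Let $\varepsilon>0$, let $x_*$ be the solution nearest to the starting point $x^0$ in the sense of $V$, and let $\Theta_0>0$ satisfy $V(x_*,x^0)\leqslant\Theta_0^2$. Suppose that for some $\omega>0$ $$\langle\nabla f(x),x-y\rangle\leqslant\omega\|\nabla f(x)\|_*\sqrt{2V(y,x)}\qquad\forall y\in Q$$ for every $x\in Q$ with $V(x_*,x)\geqslant\frac{\varepsilon^2}{2}$, and that for some $M_g>0$ $$\langle\nabla g(x),x-y\rangle\leqslant M_g\sqrt{2V(y,x)}\qquad\forall x,y\in Q.$$ Then, after the stopping criterion of the adaptive mirror descent method described in the context is fulfilled, either $$f(\widehat x)-f(x_* )\leqslant\omega^2\varepsilon\quad\text{and}\quad g(\widehat x)\leqslant\varepsilon M_g,$$ or $V(x_*,x^k)<\frac{\varepsilon^2}{2}$ for some $k$.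
   Context: $\|\cdot\|_*$ is the norm dual to a norm $\|\cdot\|$ on $\mathbb{R}^n$; $\nabla f,\nabla g$ denote subgradients. Bregman divergence: $V(y,x)=d(y)-d(x)-\langle\nabla d(x),y-x\rangle$, where $d$ is convex and differentiable on $Q$ (not necessarily strongly convex). Mirror step: $\mathrm{Mirr}_x(p)=\arg\min_{u\in Q}\{\langle p,u\rangle+V(u,x)\}$. Method. Input: $\varepsilon>0$ and $\Theta_0$ with $d(x_* )\leqslant\Theta_0^2$; $x^0=\arg\min_{x\in Q}d(x)$; $I=\emptyset$. For $k=0,1,2,\dots$: - if $g(x^k)\leqslant\varepsilon M_g$ (productive step): $h_k^f=\frac{\varepsilon}{\|\nabla f(x^k)\|_*^2}$, $x^{k+1}=\mathrm{Mirr}_{x^k}(h_k^f\nabla f(x^k))$, and $k$ is added to $I$; - otherwise (non-productive step, $k\in J$): $h_k^g=\frac{\varepsilon}{M_g}$, $x^{k+1}=\mathrm{Mirr}_{x^k}(h_k^g\nabla g(x^k))$. Stopping criterion: $$\frac{2\Theta_0^2}{\varepsilon^2}\leqslant\sum_{k\in I}\frac{\omega^2}{\|\nabla f(x^k)\|_*^2}+|J|,$$ where $|J|$ is the number of non-productive steps. Output: $\widehat x=\frac{1}{\sum_{k\in I}h_k^f}\sum_{k\in I}h_k^fx^k$. *)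

(* Defs.v *)
From HB Require Import structures.
From mathcomp Require Import all_boot all_order all_algebra.
From mathcomp Require Import all_classical all_reals all_analysis.
Set Implicit Arguments.
Unset Strict Implicit.
Unset Printing Implicit Defensive.
Import Order.TTheory GRing.Theory Num.Theory numFieldNormedType.Exports.
Local Open Scope classical_set_scope.
Local Open Scope ring_scope.

Definition dot (R : realType) (n : nat) (p u : 'rV[R]_n) : R :=
  \sum_(i < n) p 0 i * u 0 i.

(* An arbitrary norm on R^n; the library's own [`|u|] on ['rV[R]_n] is the
   sup norm and is used below only for the topology and in o(y - x), neither of
   which depends on the norm.  Nonnegativity follows from the three axioms. *)
Record is_norm (R : realType) (n : nat) (N : 'rV[R]_n -> R) : Prop := IsNorm {
  is_norm_triangle : forall u v, N (u + v) <= N u + N v ;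
  is_norm_scale : forall (a : R) u, N (a *: u) = `|a| * N u ;
  is_norm_definite : forall u, N u = 0 -> u = 0 }.

Definition dual_norm (R : realType) (n : nat) (N : 'rV[R]_n -> R)
    (p : 'rV[R]_n) : R :=
  sup [set dot p u | u in [set u | N u <= 1]].

(* Functions on Q are represented by total functions on R^n, of which only the
   values on Q matter: subgradients are taken relative to Q. *)
Definition is_subgradient (R : realType) (n : nat) (Q : set 'rV[R]_n)
    (f : 'rV[R]_n -> R) (x p : 'rV[R]_n) : Prop :=
  forall y, Q y -> f x + dot p (y - x) <= f y.

(* d(y) = d(x) + <p, y - x> + o(y - x) as y tends to x inside Q.  When d is
   differentiable at x in the full sense its gradient qualifies; at a boundary
   point of Q nothing is asked about d outside Q.  For Q convex, p is determined
   on the directions y - x with y in Q, which is all the Bregman divergence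
   uses. *)
Definition is_gradient (R : realType) (n : nat) (Q : set 'rV[R]_n)
    (d : 'rV[R]_n -> R) (x p : 'rV[R]_n) : Prop :=
  forall e : R, 0 < e -> \forall y \near within Q (nbhs x),
    `|d y - d x - dot p (y - x)| <= e * `|y - x|.

Definition bregman (R : realType) (n : nat) (d : 'rV[R]_n -> R)
    (gradd : 'rV[R]_n -> 'rV[R]_n) (y x : 'rV[R]_n) : R :=
  d y - d x - dot (gradd x) (y - x).

(* Minimizers need not be unique (d is not assumed strictly convex), so "argmin"
   is the set of all of them. *)
Definition argmin (R : realType) (T : Type) (A : set T) (F : T -> R) : set T :=
  [set x | A x /\ forall u, A u -> F x <= F u].

Definition Mirr (R : realType) (n : nat) (Q : set 'rV[R]_n)
    (d : 'rV[R]_n -> R) (gradd : 'rV[R]_n -> 'rV[R]_n) (x p : 'rV[R]_n) :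
    set 'rV[R]_n :=
  argmin Q (fun u => dot p u + bregman d gradd u x).

Definition solutions (R : realType) (n : nat) (Q : set 'rV[R]_n)
    (f g : 'rV[R]_n -> R) : set 'rV[R]_n :=
  argmin (Q `&` [set y | g y <= 0]) f.

Definition productive (R : realType) (n : nat) (g : 'rV[R]_n -> R)
    (Mg eps : R) (x : 'rV[R]_n) : bool :=
  g x <= eps * Mg.

(* Since 0^-1 = 0, a productive step with zero subgradient gets step size 0. *)
Definition step_f (R : realType) (n : nat) (N : 'rV[R]_n -> R)
    (gradf : 'rV[R]_n -> 'rV[R]_n) (eps : R) (x : 'rV[R]_n) : R :=
  eps / dual_norm N (gradf x) ^+ 2.

Definition step_g (R : realType) (Mg eps : R) : R := eps / Mg.

(* [x 0, ..., x K] are the iterates produced by the first K steps. *)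
Definition mirror_descent (R : realType) (n : nat) (Q : set 'rV[R]_n)
    (N d : 'rV[R]_n -> R) (gradd gradf : 'rV[R]_n -> 'rV[R]_n)
    (g : 'rV[R]_n -> R) (gradg : 'rV[R]_n -> 'rV[R]_n) (Mg eps : R)
    (K : nat) (x : nat -> 'rV[R]_n) : Prop :=
  argmin Q d (x 0%N) /\
  forall k, (k < K)%N ->
    Mirr Q d gradd (x k)
      (if productive g Mg eps (x k)
       then step_f N gradf eps (x k) *: gradf (x k)
       else step_g Mg eps *: gradg (x k))
      (x k.+1).

Definition stopping_criterion (R : realType) (n : nat) (N : 'rV[R]_n -> R)
    (gradf : 'rV[R]_n -> 'rV[R]_n) (g : 'rV[R]_n -> R)
    (Mg eps omega Theta0 : R) (K : nat) (x : nat -> 'rV[R]_n) : Prop :=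
  2 * Theta0 ^+ 2 / eps ^+ 2 <=
    \sum_(k < K | productive g Mg eps (x k))
       omega ^+ 2 / dual_norm N (gradf (x k)) ^+ 2
    + #|[pred k : 'I_K | ~~ productive g Mg eps (x k)]|%:R.

Definition output (R : realType) (n : nat) (N : 'rV[R]_n -> R)
    (gradf : 'rV[R]_n -> 'rV[R]_n) (g : 'rV[R]_n -> R) (Mg eps : R)
    (K : nat) (x : nat -> 'rV[R]_n) : 'rV[R]_n :=
  (\sum_(k < K | productive g Mg eps (x k)) step_f N gradf eps (x k))^-1 *:
  \sum_(k < K | productive g Mg eps (x k)) step_f N gradf eps (x k) *: x k.

(* Main.v *)
Require Import Defs.
From HB Require Import structures.
From mathcomp Require Import all_boot all_order all_algebra.
From mathcomp Require Import all_classical all_reals all_analysis.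
From mathcomp Require Import ring lra.
Set Implicit Arguments.
Unset Strict Implicit.
Unset Printing Implicit Defensive.
Import Order.TTheory GRing.Theory Num.Theory numFieldNormedType.Exports.
Local Open Scope classical_set_scope.
Local Open Scope ring_scope.

(** Suppose that every iterate satisfies V(xstar, x^k) >= eps^2 / 2, so that the
    relative Lipschitz bound on f is available at each of them.

    One mirror step with step size h along q, where
    <q, x - x+> <= L * sqrt (2 V(x+, x)), satisfies
    h <q, x - u> <= (h L)^2 / 2 + V(u, x) - V(u, x+)  ([Mirr_step_bound]):
    the three-point inequality [Mirr_three_points] leaves a term - V(x+, x),
    which absorbs h L sqrt (2 V(x+, x)) by Young's inequality.  Take u = xstar,
    bound <q, x^k - xstar> below by the subgradient inequality, and measure
    each step by its gap

    - h_k (f(x^k) - f(xstar) - omega^2 eps)  on a productive step,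
    - h_k (g(x^k) - eps Mg)                  on a non-productive one.

    The step sizes are chosen so that the quadratic term is half of what the gap
    subtracts; hence each gap is at most
    V(xstar, x^k) - V(xstar, x^(k+1)) - eps^2 / 2 * w_k, where w_k is the
    contribution of step k to the stopping criterion.  The sum telescopes, and
    the stopping criterion says precisely that it is nonpositive.

    Non-productive gaps are positive, so the productive gaps sum to at most 0.
    If the productive step sizes summed to 0, the productive gaps would vanish,
    there would be no non-productive step, and the right-hand side of the
    stopping criterion would be 0, against Theta0 > 0.  So the output is a
    genuine convex combination of iterates, and Jensen's inequality
    ([subgradient_weighted_sum]) gives both bounds. *)

(** * Linearity of the pairing *)

Lemma dotC (R : realType) n (p u : 'rV[R]_n) : dot p u = dot u p.
Proof. by apply: eq_bigr => i _; rewrite mulrC. Qed.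

Lemma dot_is_linear (R : realType) n (p : 'rV[R]_n) : linear_for *%R (dot p).
Proof.
move=> a u v; rewrite /dot mulr_sumr -big_split /=.
by apply: eq_bigr => i _; rewrite !mxE mulrDr mulrCA.
Qed.

HB.instance Definition _ (R : realType) n (p : 'rV[R]_n) :=
  GRing.isLinear.Build R 'rV[R]_n R *%R (dot p) (@dot_is_linear R n p).

Lemma dotZr (R : realType) n (p : 'rV[R]_n) a u : dot p (a *: u) = a * dot p u.
Proof. exact: linearZ. Qed.

Lemma dotBr (R : realType) n (p u v : 'rV[R]_n) :
  dot p (u - v) = dot p u - dot p v.
Proof. exact: linearB. Qed.

Lemma dotZl (R : realType) n (p : 'rV[R]_n) a u : dot (a *: p) u = a * dot p u.
Proof. by rewrite dotC dotZr dotC. Qed.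

(** * Convexity and differentiability along segments *)

Lemma segmentE (R : realType) n (x y : 'rV[R]_n) (t : R) :
  x + t *: (y - x) = t *: y + (1 - t) *: x.
Proof. by rewrite scalerBl scale1r scalerBr addrCA. Qed.

Lemma convex_set_segment (R : realType) n (Q : set 'rV[R]_n) x y (t : R) :
  convex_set Q -> Q x -> Q y -> 0 <= t -> t <= 1 -> Q (x + t *: (y - x)).
Proof.
move=> cQ Qx Qy t0 t1.
have t01 : Itv.spec (@Itv.num_sem R) (Itv.Real `[0%Z, 1%Z]) t.
  by rewrite /Itv.num_sem /= in_itv /= t0 t1 realE t0.
rewrite segmentE.
by have := cQ y x (Itv.Def t01); rewrite !inE; apply.
Qed.

Lemma convex_function_segment (R : realType) n (Q : set 'rV[R]_n) f x y (t : R) :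
  convex_function Q f -> Q x -> Q y -> 0 <= t -> t <= 1 ->
  f (x + t *: (y - x)) <= f x + t * (f y - f x).
Proof.
move=> cf Qx Qy t0 t1.
have t01 : Itv.spec (@Itv.num_sem R) (Itv.Real `[0%Z, 1%Z]) t.
  by rewrite /Itv.num_sem /= in_itv /= t0 t1 realE t0.
have -> : f x + t * (f y - f x) = t * f y + (1 - t) * f x by ring.
rewrite segmentE.
by have := cf (Itv.Def t01) y x; rewrite !inE; apply.
Qed.

(** Differentiability is only ever used along a segment of Q, and there only for
    one small t at a time: every consequence below is a linear inequality that
    holds up to t * e, hence, after division by t, up to an arbitrary e. *)
Lemma is_gradient_segment (R : realType) n (Q : set 'rV[R]_n) d x y p (e : R) :
  convex_set Q -> is_gradient Q d x p -> Q x -> Q y -> 0 < e ->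
  exists t, [/\ 0 < t, t <= 1 &
    `|d (x + t *: (y - x)) - d x - t * dot p (y - x)| <= t * e].
Proof.
move=> cQ dp Qx Qy e0; set v := y - x.
have v1 : 0 < 1 + `|v| by rewrite ltr_wpDr.
have /nbhs_ballP[r /= r0 rd] := dp _ (divr_gt0 e0 v1).
have den : 0 < r + (1 + `|v|) by rewrite addr_gt0.
(* t <= 1, and t * `|v| < r keeps x + t *: v in the ball. *)
set t := r / (r + (1 + `|v|)).
have t0 : 0 < t by rewrite divr_gt0.
have t1 : t <= 1 by rewrite ler_pdivrMr // mul1r lerDl ltW.
exists t; split => //.
have dist : x + t *: v - x = t *: v by rewrite addrC addKr.
have tv : `|t *: v| = t * `|v| by rewrite normrZ gtr0_norm.
have Bt : ball x r (x + t *: v).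
  rewrite -ball_normE /= distrC dist tv mulrAC ltr_pdivrMr // ltr_pM2l //.
  lra.
have := rd _ Bt (convex_set_segment cQ Qx Qy (ltW t0) t1).
rewrite dist dotZr => /le_trans; apply; rewrite tv mulrCA ler_pM2l //.
by rewrite mulrAC ler_pdivrMr // ler_pM2l // lerDr.
Qed.

Lemma is_gradient_subgradient (R : realType) n (Q : set 'rV[R]_n) d x p :
  convex_set Q -> convex_function Q d -> Q x -> is_gradient Q d x p ->
  is_subgradient Q d x p.
Proof.
move=> cQ cd Qx dp y Qy; apply/ler_addgt0Pr => e e0.
have [t [t0 t1 /ler_normlP[+ _]]] := is_gradient_segment cQ dp Qx Qy e0.
have := convex_function_segment cd Qx Qy (ltW t0) t1.
move=> A B; rewrite -subr_ge0 -(pmulr_rge0 _ t0); lra.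
Qed.

(** * One mirror step *)

Lemma bregman_ge0 (R : realType) n (Q : set 'rV[R]_n) d gradd x y :
  convex_set Q -> convex_function Q d ->
  is_gradient Q d x (gradd x) -> Q x -> Q y ->
  0 <= bregman d gradd y x.
Proof.
move=> cQ cd dp Qx Qy.
by have := is_gradient_subgradient cQ cd Qx dp Qy; rewrite /bregman; lra.
Qed.

(** The first-order optimality condition
    <p + gradd xp - gradd x, u - xp> >= 0 of the minimizer xp, rewritten with
    the identity <gradd xp - gradd x, u - xp> = V(u, x) - V(u, xp) - V(xp, x).
    The condition comes from comparing xp with a nearby point of the segment
    from xp to u. *)
Lemma Mirr_three_points (R : realType) n (Q : set 'rV[R]_n) d gradd x p xp u :
  convex_set Q -> is_gradient Q d xp (gradd xp) -> Q u ->
  Mirr Q d gradd x p xp ->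
  dot p (xp - u) <=
    bregman d gradd u x - bregman d gradd u xp - bregman d gradd xp x.
Proof.
move=> cQ dp Qu [Qxp minxp]; apply/ler_addgt0Pr => e e0.
have [t [t0 t1 /ler_normlP[_]]] := is_gradient_segment cQ dp Qxp Qu e0.
have := minxp _ (convex_set_segment cQ Qxp Qu (ltW t0) t1).
rewrite /bregman; set xt := xp + _ *: _.
have E q : dot q xt = dot q xp + t * dot q (u - xp).
  by rewrite linearD /= dotZr.
rewrite !dotBr !E !dotBr => A B.
rewrite -subr_ge0 -(pmulr_rge0 _ t0); lra.
Qed.

(** Splitting <q, x - u> at xp, the part towards u is the three-point inequality
    and the part h * L * s, with s ^+ 2 / 2 = V(xp, x), is at most
    (h * L) ^+ 2 / 2 + s ^+ 2 / 2.  Nonnegativity of V makes s a true root. *)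
Lemma Mirr_step_bound (R : realType) n (Q : set 'rV[R]_n) d gradd x q xp u
    (h L : R) :
  convex_set Q -> convex_function Q d ->
  (forall z, Q z -> is_gradient Q d z (gradd z)) ->
  Q x -> Q u -> 0 <= h ->
  dot q (x - xp) <= L * Num.sqrt (2 * bregman d gradd xp x) ->
  Mirr Q d gradd x (h *: q) xp ->
  h * dot q (x - u) <=
    (h * L) ^+ 2 / 2 + bregman d gradd u x - bregman d gradd u xp.
Proof.
move=> cQ cd dd Qx Qu h0 qL Mxp; have Qxp := Mxp.1.
have := Mirr_three_points cQ (dd _ Qxp) Qu Mxp.
have V0 := bregman_ge0 cQ cd (dd _ Qx) Qx Qxp.
have := ler_wpM2l h0 qL.
have := sqr_sqrtr (mulr_ge0 (ler0n _ 2) V0).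
move: (Num.sqrt _) => s sE.
have : 0 <= (h * L - s) ^+ 2 by exact: sqr_ge0.
rewrite dotZl !dotBr; nra.
Qed.

(** * Convex combinations *)

(** Stated without dividing by the total weight, so that the property is stable
    under addition even when some partial sums of weights vanish; q0 is the
    witness in the case of total weight 0. *)
Lemma convex_set_weighted_sum (R : realType) n (Q : set 'rV[R]_n)
    (I : Type) (r : seq I) (P : pred I) (a : I -> R) (y : I -> 'rV[R]_n) q0 :
  convex_set Q -> Q q0 -> (forall i, P i -> 0 <= a i) ->
  (forall i, P i -> Q (y i)) ->
  exists2 q, Q q &
    \sum_(i <- r | P i) a i *: y i = (\sum_(i <- r | P i) a i) *: q.
Proof.
move=> cQ Qq0 a0 Qy.
pose K (v : 'rV[R]_n) (s : R) := 0 <= s /\ exists2 q, Q q & v = s *: q.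
suff [] : K (\sum_(i <- r | P i) a i *: y i) (\sum_(i <- r | P i) a i) by [].
apply: (big_ind2 K) => [|v1 s1 v2 s2 [s10 [q1 Q1 ->]] [s20 [q2 Q2 ->]]|i Pi].
- by split=> //; exists q0; rewrite // scale0r.
- split; first exact: addr_ge0.
  have [/eqP|s0] := eqVneq (s1 + s2) 0.
    rewrite paddr_eq0 // => /andP[/eqP -> /eqP ->].
    by exists q0; rewrite // addr0 !scale0r addr0.
  have sgt0 : 0 < s1 + s2 by rewrite lt_neqAle eq_sym s0 addr_ge0.
  exists (q1 + (s2 / (s1 + s2)) *: (q2 - q1)).
    apply: convex_set_segment => //; first by rewrite divr_ge0 // ltW.
    by rewrite ler_pdivrMr // mul1r lerDr.
  rewrite scalerDr scalerA mulrCA divff // mulr1 scalerBr scalerDl.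
  by rewrite addrACA subrr addr0.
- by split; [exact: a0 | exists (y i); [exact: Qy|]].
Qed.

(** Jensen's inequality at a point with a subgradient: average the subgradient
    inequalities at the barycentre z, where the linear terms cancel. *)
Lemma subgradient_weighted_sum (R : realType) n (Q : set 'rV[R]_n) f z p
    (I : Type) (r : seq I) (P : pred I) (a : I -> R) (y : I -> 'rV[R]_n) :
  is_subgradient Q f z p ->
  (forall i, P i -> 0 <= a i) -> (forall i, P i -> Q (y i)) ->
  \sum_(i <- r | P i) a i *: y i = (\sum_(i <- r | P i) a i) *: z ->
  (\sum_(i <- r | P i) a i) * f z <= \sum_(i <- r | P i) a i * f (y i).
Proof.
move=> fp a0 Qy zE.
have : \sum_(i <- r | P i) a i * (f z + dot p (y i - z)) <=
       \sum_(i <- r | P i) a i * f (y i).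
  by apply: ler_sum => i Pi; rewrite ler_wpM2l ?a0 //; apply/fp/Qy.
apply: le_trans; rewrite le_eqVlt; apply/orP; left; apply/eqP.
under [RHS]eq_bigr do rewrite mulrDr -dotZr scalerBr.
rewrite big_split /= -linear_sum /= sumrB zE.
by rewrite -[X in dot p (_ - X)]scaler_suml subrr linear0 addr0 mulr_suml.
Qed.

(** * Convergence of the method *)

Theorem mainTheorem6 (R : realType) (n : nat)
    (N : 'rV[R]_n -> R) (Q : set 'rV[R]_n)
    (f g d : 'rV[R]_n -> R) (gradf gradg gradd : 'rV[R]_n -> 'rV[R]_n)
    (eps Theta0 omega Mg : R) (xstar : 'rV[R]_n)
    (K : nat) (x : nat -> 'rV[R]_n) :
  is_norm N ->
  closed Q -> convex_set Q ->
  convex_function Q f -> convex_function Q g ->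
  (forall z, Q z -> is_subgradient Q f z (gradf z)) ->
  (forall z, Q z -> is_subgradient Q g z (gradg z)) ->
  convex_function Q d ->
  (forall z, Q z -> is_gradient Q d z (gradd z)) ->
  0 < eps -> 0 < Theta0 -> 0 < omega -> 0 < Mg ->
  argmin (solutions Q f g) (fun z => bregman d gradd z (x 0%N)) xstar ->
  bregman d gradd xstar (x 0%N) <= Theta0 ^+ 2 ->
  (forall z, Q z -> eps ^+ 2 / 2 <= bregman d gradd xstar z ->
     forall y, Q y ->
       dot (gradf z) (z - y)
         <= omega * dual_norm N (gradf z)
              * Num.sqrt (2 * bregman d gradd y z)) ->
  (forall z y, Q z -> Q y ->
     dot (gradg z) (z - y) <= Mg * Num.sqrt (2 * bregman d gradd y z)) ->
  mirror_descent Q N d gradd gradf g gradg Mg eps K x ->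
  stopping_criterion N gradf g Mg eps omega Theta0 K x ->
  (let xhat := output N gradf g Mg eps K x in
   f xhat - f xstar <= omega ^+ 2 * eps /\ g xhat <= eps * Mg)
  \/ (exists2 k : nat, (k < K)%N & bregman d gradd xstar (x k) < eps ^+ 2 / 2).
Proof.
move=> _ _ cQ _ _ fsub gsub cd dgrad e0 Th0 om0 Mg0 [[[Qs gs] _] _] V0le
  fL gL [[Qx0 _] steps] stop.
have [[k kK Vk]|far] :=
  pselect (exists2 k, (k < K)%N & bregman d gradd xstar (x k) < eps ^+ 2 / 2).
  by right; exists k.
left.
have {far} Vfar k : (k < K)%N -> eps ^+ 2 / 2 <= bregman d gradd xstar (x k).
  by move=> kK; rewrite leNgt; apply/negP => Vk; apply: far; exists k.
have Qx k : (k <= K)%N -> Q (x k).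
  by case: k => [//|k] kK; have [] := steps _ kK.
have QxI (k : 'I_K) : Q (x k) by apply/Qx/ltnW.
set V := fun k => bregman d gradd xstar (x k).
set I := fun k => productive g Mg eps (x k).
set h := fun k => step_f N gradf eps (x k).
set c := fun k => omega ^+ 2 / dual_norm N (gradf (x k)) ^+ 2.
have h0 k : 0 <= h k by rewrite divr_ge0 ?sqr_ge0 // ltW.
have hc k : omega ^+ 2 * h k = eps * c k by rewrite /h /c /step_f; ring.
set gap := fun k => if I k then h k * (f (x k) - f xstar - omega ^+ 2 * eps)
                    else step_g Mg eps * (g (x k) - eps * Mg).
have sMg : step_g Mg eps * Mg = eps by rewrite divfK ?gt_eqF.
have gap_step (k : 'I_K) :
    gap k <= V k - V k.+1 - eps ^+ 2 / 2 * (if I k then c k else 1).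
  have Qx1 := Qx _ (ltn_ord k).
  have := steps _ (ltn_ord k); rewrite -/(I k) /gap; case: ifP => Ik step.
  - have := Mirr_step_bound cQ cd dgrad (QxI k) Qs (h0 k)
      (fL _ (QxI k) (Vfar _ (ltn_ord k)) _ Qx1) step.
    have := ler_wpM2l (h0 k) (fsub _ (QxI k) _ Qs).
    have -> : (h k * (omega * dual_norm N (gradf (x k)))) ^+ 2 = eps ^+ 2 * c k.
      (* A zero dual norm gives h k = c k = 0, so it needs its own case. *)
      rewrite expr2 /h /c /step_f.
      have [->|dn0] := eqVneq (dual_norm N (gradf (x k))) 0.
        by rewrite expr0n /= invr0 !mulr0.
      by field.
    rewrite !dotBr -/(V k) -/(V k.+1); have := hc k; nra.
  - have s0 : 0 <= step_g Mg eps by rewrite divr_ge0 // ltW.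
    have := Mirr_step_bound cQ cd dgrad (QxI k) Qs s0
      (gL _ _ (QxI k) Qx1) step.
    have := ler_wpM2l s0 (gsub _ (QxI k) _ Qs).
    have := ler_wpM2l s0 gs.
    rewrite !dotBr -/(V k) -/(V k.+1) sMg; nra.
have gap_sum : \sum_(k < K) gap k <= 0.
  have : \sum_(k < K) gap k <= \sum_(k < K)
      (V k - V k.+1 - eps ^+ 2 / 2 * (if I k then c k else 1)).
    exact: ler_sum.
  have tele : \sum_(k < K) (V k - V k.+1) = V 0%N - V K.
    elim: (K) => [|m IH]; first by rewrite big_ord0 subrr.
    by rewrite big_ord_recr /= IH addrA subrK.
  have weights : \sum_(k < K) (if I k then c k else 1) =
      \sum_(k < K | I k) c k + #|[pred k : 'I_K | ~~ I k]|%:R.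
    rewrite (bigID (fun k : 'I_K => I k)) /=; congr (_ + _).
      by apply: eq_bigr => k ->.
    rewrite -sumr_const; apply: eq_big => [k|k /negbTE ->] //.
  rewrite sumrB tele -mulr_sumr weights => /le_trans; apply.
  have VK : 0 <= V K by apply: bregman_ge0 cQ cd (dgrad _ _) _ Qs; apply: Qx.
  move: stop; rewrite /stopping_criterion -/I ler_pdivrMr ?exprn_gt0 //.
  rewrite -/(V 0%N) in V0le *; lra.
have gapJ (k : 'I_K) : ~~ I k -> 0 < gap k.
  move=> Ik; rewrite /gap (negbTE Ik) mulr_gt0 ?divr_gt0 //.
  by rewrite subr_gt0 ltNge.
have gapJ0 (k : 'I_K) : ~~ I k -> 0 <= gap k by move=> /gapJ /ltW.
have gapI : \sum_(k < K | I k) gap k <= - \sum_(k < K | ~~ I k) gap k.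
  by rewrite -subr_le0 opprK -(bigID (fun k : 'I_K => I k) xpredT).
(* The output divides by S, so S = 0 has to be excluded: it would make all
   productive gaps and weights vanish. *)
set S := \sum_(k < K | I k) h k.
have S0 : 0 < S.
  have Sge0 : 0 <= S by apply: sumr_ge0.
  rewrite lt_neqAle Sge0 andbT eq_sym; apply/negP => /eqP Seq0.
  have hI (k : 'I_K) : I k -> h k = 0 by apply: psumr_eq0P Seq0 k.
  have allI (k : 'I_K) : I k.
    apply: contraT => Jk; have := gapJ _ Jk.
    rewrite (psumr_eq0P gapJ0) ?ltxx //.
    apply/le_anti; rewrite sumr_ge0 // andbT.
    move: gapI; rewrite big1 ?oppr_ge0 // => i Ii.
    by rewrite /gap Ii hI // mul0r.
  move: stop; rewrite /stopping_criterion -/I.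
  rewrite big1 => [|k Ik]; last first.
    apply/eqP; have /esym/eqP := hc k.
    by rewrite hI // mulr0 mulf_eq0 gt_eqF.
  rewrite eq_card0 => [|k]; last exact: negbF (allI k).
  by rewrite addr0 leNgt divr_gt0 ?mulr_gt0 ?exprn_gt0.
have [q Qq qE] : exists2 q, Q q & \sum_(k < K | I k) h k *: x k = S *: q.
  by apply: (convex_set_weighted_sum _ cQ Qs) => k _.
have xhatE : output N gradf g Mg eps K x = q.
  by rewrite /output -/I qE scalerA mulVf ?scale1r // gt_eqF.
rewrite xhatE; split; rewrite -(ler_pM2l S0).
- have := subgradient_weighted_sum (fsub _ Qq)
    (fun (k : 'I_K) _ => h0 k) (fun k _ => QxI k) qE.
  have : \sum_(k < K | I k) h k * (f (x k) - f xstar - omega ^+ 2 * eps) <= 0.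
    rewrite (eq_bigr (fun k : 'I_K => gap k)) => [|k Ik]; last by rewrite /gap Ik.
    by apply: le_trans gapI _; rewrite oppr_le0 sumr_ge0.
  under eq_bigr do rewrite -addrA -opprD mulrBr.
  rewrite sumrB -mulr_suml -/S; lra.
- apply: le_trans (subgradient_weighted_sum (gsub _ Qq)
    (fun (k : 'I_K) _ => h0 k) (fun k _ => QxI k) qE) _.
  by rewrite mulr_suml; apply: ler_sum => k Ik; rewrite ler_wpM2l.
Qed.
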